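(* Let $C_m=\frac{1}{m+1}\binom{2m}{m}$ denote the $m$-th Catalan number. Label the vertices of a regular convex $N$-gon by $0,1,\ldots,N-1$ in cyclic order. For vertices $x\neq y$, let $f_{xy}(N)$ denote the number of triangulations of this $N$-gon that contain no diagonal parallel to the segment $xy$. Then: (i) for every $n\ge 2$, $f_{01}(2n)=2C_{2n-3}$; (ii) for every $n\ge 2$, $f_{02}(2n)=C_{2n-1}+2C_{2n-2}-2^{2n-1}C_{n-1}$; (iii) for every $n\ge 1$, $f_{01}(2n+1)=2^{2n-1}C_{n-1}-C_{2n-1}$.
   Context: A triangulation of a convex $N$-gon is a maximal set of pairwise non-crossing diagonals (there are $N-3$ of them), viewed as a graph on the vertices $0,\ldots,N-1$ whose edges are the $N$ sides $01,12,\ldots,(N-1)0$ together with these diagonals; there are $C_{N-2}$ triangulations. Here $xy$ may be a side (e.g. $01$) or a diagonal (e.g. $02$) of the regular polygon, and ''parallel'' means parallel as line segments in the regular $N$-gon (equivalently, $ab$ is parallel to $cd$ iff $a+b\equiv c+d \pmod N$). *)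

(* Defs.v *)
From mathcomp Require Import all_boot all_order all_algebra.
Set Implicit Arguments. Unset Strict Implicit. Unset Printing Implicit Defensive.

Definition catalan (m : nat) : nat := 'C(m.*2, m) %/ m.+1.

(* Vertices of the convex N-gon are 'I_N, in cyclic order.
   A diagonal is represented by the ordered pair (a,b) with a < b, which is
   not a side: b - a >= 2 and (a,b) <> (0, N-1). *)
Definition is_diag (N : nat) (d : 'I_N * 'I_N) : bool :=
  (d.1.+1 < d.2) && ~~ ((d.1 == 0 :> nat) && (d.2 == N.-1 :> nat)).

Definition cross (N : nat) (d e : 'I_N * 'I_N) : bool :=
  ((d.1 < e.1 < d.2) && (d.2 < e.2)) || ((e.1 < d.1 < e.2) && (e.2 < d.2)).

Definition noncrossing (N : nat) (T : {set 'I_N * 'I_N}) : bool :=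
  [forall d in T, forall e in T, ~~ cross d e].

Definition triangulation (N : nat) (T : {set 'I_N * 'I_N}) : bool :=
  [&& [forall d in T, is_diag d], noncrossing T &
      [forall d, (is_diag d && (d \notin T)) ==> ~~ noncrossing (d |: T)]].

Definition parallel (N : nat) (a b c d : nat) : bool := a + b == c + d %[mod N].

Definition f_count (x y N : nat) : nat :=
  #|[set T : {set 'I_N * 'I_N} | triangulation T &&
      [forall d in T, ~~ parallel N d.1 d.2 x y]]|.

(* Main.v *)
(* Order a parallel class of diagonals outwards from the vertex or side of the
   polygon in its middle.  A triangulation either avoids the class or has a first
   member [d_j] in it; cutting along [d_j] leaves an inner polygon whose
   triangulation avoids [d_0, ..., d_(j-1)] and an unrestricted outer polygon.  So
   the numbers [b_j] of inner triangulations satisfy [B G = Q] (middle vertex) or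
   [x B G = G - 1] (middle side), where [G] and [Q] have coefficients [C_(2i)] and
   [C_(2i+1)].  Splitting Segner's recurrence by parity gives [G = 1 + 2xGQ] and
   [Q = G^2 + xQ^2], whence [G^2 = 1 + 4x(G^2)^2], i.e. [G^2] has coefficients
   [4^i C_i], and [Q / G = 2G^2 - Q].

   The Catalan count itself also comes from cutting: every triangulation has
   [k - 3] diagonals, so counting pairs (triangulation, diagonal in it) gives
   [(k - 3) t_k = sum_d t_inner(d) t_outer(d)]. *)
Require Import Defs.
From mathcomp Require Import all_boot all_order all_algebra.
From mathcomp Require Import zify ring.
Set Implicit Arguments. Unset Strict Implicit. Unset Printing Implicit Defensive.
Import Order.TTheory GRing.Theory Num.Theory.

(** * Catalan numbers *)

Lemma catalan_bin m : catalan m * m.+1 = 'C(m.*2, m).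
Proof.
have H := mul_bin_left m.*2 m.
have E : m.*2 - m = m by rewrite -addnn addnK.
(* The witness is the ballot form of the Catalan number, a difference of neighbouring binomials. *)
rewrite /catalan divnK //; apply/dvdnP; exists ('C(m.*2, m) - 'C(m.*2, m.+1)).
rewrite E in H; nia.
Qed.

Lemma catalanS m : m.+2 * catalan m.+1 = 2 * (m.*2.+1) * catalan m.
Proof.
have H0 := catalan_bin m; have H1 := catalan_bin m.+1.
have H2 := mul_bin_diag m.*2.+2 m; have H3 := mul_bin_down m.*2.+1 m.
have E : m.*2.+1 - m = m.+1 by lia.
rewrite E /= in H3; rewrite doubleS in H1; rewrite /= in H2.
nia.
Qed.

(** Adding the sum to its image under [i -> m - i] turns the weights into the constant [m]. *)
Lemma sum_conv_sym (F : nat -> nat) m :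
  2 * (\sum_(i < m.+1) i * (F i * F (m - i))) = m * \sum_(i < m.+1) F i * F (m - i).
Proof.
rewrite mul2n -addnn {2}(reindex_inj rev_ord_inj) /= -big_split /= big_distrr /=.
apply: eq_bigr => i _; rewrite subSS subKn; last by rewrite -ltnS.
by rewrite (mulnC (F (m - i))) -mulnDl subnKC // -ltnS.
Qed.

(** Induction, evaluating the sum of [(i + 1) C_i C_(m+1-i)] twice. By symmetry it is half of
    [m + 3] times the convolution. Splitting off [i = 0] and applying [catalanS] to each [C_(i+1)]
    gives [(2m + 3) C_(m+1)], which is half of [(m + 3) C_(m+2)]. *)
Lemma segner m : catalan m.+1 = \sum_(i < m.+1) catalan i * catalan (m - i).
Proof.
elim: m => [|m IH]; first by rewrite big_ord1.
pose S k := \sum_(i < k.+1) catalan i * catalan (k - i).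
have H1 := sum_conv_sym catalan m; have H2 := sum_conv_sym catalan m.+1.
have : \sum_(i < m.+1) i.+2 * catalan i.+1 * catalan (m - i) =
       \sum_(i < m.+1) 2 * i.*2.+1 * catalan i * catalan (m - i).
  by apply: eq_bigr => i _; rewrite catalanS.
have -> : \sum_(i < m.+1) 2 * i.*2.+1 * catalan i * catalan (m - i) =
   4 * (\sum_(i < m.+1) i * (catalan i * catalan (m - i))) + 2 * S m.
  rewrite /S !big_distrr /= -big_split; apply: eq_bigr => i _ /=; lia.
have : \sum_(i < m.+2) i.+1 * (catalan i * catalan (m.+1 - i)) =
   \sum_(i < m.+2) i * (catalan i * catalan (m.+1 - i)) + S m.+1.
  rewrite /S -big_split; apply: eq_bigr => i _ /=; lia.
rewrite big_ord_recl subn0 /= => E1 E2.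
have E3 : \sum_(i < m.+1) (lift ord0 i).+1 * (catalan (lift ord0 i) * catalan (m.+1 - lift ord0 i))
  = \sum_(i < m.+1) i.+2 * catalan i.+1 * catalan (m - i).
  by apply: eq_bigr => i _; rewrite lift0 subSS mulnA.
rewrite E3 E2 in E1; have C := catalanS m.+1.
rewrite -/(S m) in IH H1; rewrite -/(S m.+1) in H2 *.
have c0 : catalan 0 = 1 by [].
rewrite c0 in E1; rewrite -IH in E1 H1; clear E2 E3.
move: C H1 H2 E1; rewrite -mul2n; set x := \sum_(_ < _) _; set y := \sum_(_ < _) _.
move: (S m.+1) (catalan m.+1) (catalan m.+2) x y => s c c2 x y C H1 H2 E1.
have K : m.+3 * s = m.+3 * c2 by lia.
by apply/eqP; rewrite eq_sym -(@eqn_pmul2l m.+3) // K.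
Qed.

Lemma sum_double (F : nat -> nat) m :
  \sum_(i < m.*2) F i = \sum_(i < m) (F i.*2 + F i.*2.+1).
Proof.
elim: m => [|m IH]; first by rewrite !big_ord0.
by rewrite doubleS !big_ord_recr /= IH addnA.
Qed.

(** The two indices have odd sum, so exactly one is even; reversal exchanges the two cases, whence
    the factor 2. *)
Lemma segner_even j :
  catalan j.+1.*2 = 2 * \sum_(i < j.+1) catalan i.*2 * catalan (j - i).*2.+1.
Proof.
rewrite doubleS segner (sum_double (fun i => catalan i * catalan (j.*2.+1 - i)) j.+1).
rewrite big_split [RHS]mulSn mul1n /=.
congr (_ + _).
  by apply: eq_bigr => i _; congr (_ * catalan _); have := ltn_ord i; lia.
rewrite [RHS](reindex_inj rev_ord_inj) /=; apply: eq_bigr => i _.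
by rewrite mulnC; congr (catalan _ * catalan _); have := ltn_ord i; lia.
Qed.

(** The two indices have even sum: both are even or both odd. For [j = 0] the odd sum is empty, so
    [j.-1] does no harm. *)
Lemma segner_odd j :
  catalan j.*2.+1 = \sum_(i < j.+1) catalan i.*2 * catalan (j - i).*2 +
                    \sum_(i < j) catalan i.*2.+1 * catalan (j.-1 - i).*2.+1.
Proof.
rewrite segner big_ord_recr (sum_double (fun i => catalan i * catalan (j.*2 - i))).
rewrite big_split /= [in RHS]big_ord_recr /=.
rewrite !subnn addnAC; congr (_ + _ + _); apply: eq_bigr => i _;
  by congr (_ * catalan _); have := ltn_ord i; lia.
Qed.

(** * Even and odd halves of the Catalan series, as truncated polynomials *)

Section GeneratingFunctions.

Local Open Scope ring_scope.

Definition ceven (i : nat) : int := (catalan i.*2)%:Z.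
Definition codd (i : nat) : int := (catalan i.*2.+1)%:Z.
Definition cpow (i : nat) : int := (4 ^ i * catalan i)%N%:Z.

(** Divisibility by [X^M]. An identity of series is proved by writing its defect, with [ring], as a
    combination of residuals that are [small]. *)
Definition small (M : nat) (p : {poly int}) := forall i, (i < M)%N -> p`_i = 0.

Lemma smallD M p q : small M p -> small M q -> small M (p + q).
Proof. by move=> hp hq i hi; rewrite coefD hp // hq // addr0. Qed.

Lemma smallM M p q : small M p -> small M (q * p).
Proof.
move=> hp i hi; rewrite coefM big1 // => j _; rewrite hp ?mulr0 //.
by apply: leq_ltn_trans hi; rewrite leq_subr.
Qed.

Lemma coef_truncM (u v : nat -> int) M i : (i < M)%N ->
  ((\poly_(k < M) u k) * (\poly_(k < M) v k))`_i = \sum_(j < i.+1) u j * v (i - j)%N.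
Proof.
move=> hi; rewrite coefM; apply: eq_bigr => j _; rewrite !coef_poly.
have hj : (j <= i)%N by rewrite -ltnS.
by rewrite (leq_ltn_trans hj hi) (leq_ltn_trans (leq_subr j i) hi).
Qed.

Lemma ceven_conv i :
  ceven i.+1 = \sum_(j < i.+1) ceven j * codd (i - j)%N *+ 2.
Proof.
rewrite /ceven segner_even PoszM (big_morph Posz PoszD erefl) big_distrr /=.
by apply: eq_bigr => j _; rewrite PoszM /codd mulr2n; ring.
Qed.

Lemma codd_conv i :
  codd i = \sum_(j < i.+1) ceven j * ceven (i - j)%N +
           \sum_(j < i) codd j * codd (i.-1 - j)%N.
Proof.
rewrite /codd segner_odd PoszD !(big_morph Posz PoszD erefl).
by congr (_ + _); apply: eq_bigr => j _; rewrite PoszM.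
Qed.

Lemma cpow_conv i :
  cpow i.+1 = \sum_(j < i.+1) cpow j * cpow (i - j)%N *+ 4.
Proof.
rewrite /cpow segner big_distrr /= (big_morph Posz PoszD erefl).
apply: eq_bigr => j _.
have -> : (4 ^ i.+1 = 4 ^ j * 4 ^ (i - j) * 4)%N.
  by rewrite -expnD -expnSr; congr (_ ^ _.+1)%N; have := ltn_ord j; lia.
by rewrite !PoszM; ring.
Qed.

(* The residuals of [G = 1 + 2xGQ] and [Q = G^2 + xQ^2], where [G] and [Q] are
   the even and odd halves of the Catalan generating function. *)
Lemma small_ceven M (G := \poly_(i < M) ceven i) (Q := \poly_(i < M) codd i) :
  small M (G - 1 - 'X * (G * Q) *+ 2).
Proof.
rewrite /G /Q => -[|i] hi; rewrite !coefB coefMn coefXM coef1 coef_poly hi /=; first by [].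
by rewrite coef_truncM ?(ltnW hi) // ceven_conv sumrMnl subr0 subrr.
Qed.

Lemma small_codd M (G := \poly_(i < M) ceven i) (Q := \poly_(i < M) codd i) :
  small M (Q - G * G - 'X * (Q * Q)).
Proof.
rewrite /G /Q => i hi; have hi' := leq_ltn_trans (leq_pred i) hi.
rewrite !coefB coefXM !coef_truncM // coef_poly hi codd_conv.
by case: i {hi hi'} => [|i] /=; rewrite ?big_ord0; ring.
Qed.

(** The equation [P = 1 + 4xP^2] for [P = G^2] fixes each coefficient from the earlier ones, and
    [cpow] obeys the same recurrence. *)
Lemma ceven_square i : \sum_(j < i.+1) ceven j * ceven (i - j)%N = cpow i.
Proof.
elim/ltn_ind: i => -[|i] IH; first by rewrite big_ord1.
pose M := i.+2; pose G := \poly_(k < M) ceven k; pose Q := \poly_(k < M) codd k.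
have hG := @small_ceven M; have hQ := @small_codd M.
rewrite -/G -/Q in hG hQ.
have : small M (G * G - 1 - 'X * ((G * G) * (G * G)) *+ 4).
  (* Elimination of [Q]: the second equation gives [(1 - 2xQ)^2 = 1 - 4xG^2], and the first is
     [G(1 - 2xQ) = 1]. *)
  have -> : G * G - 1 - 'X * ((G * G) * (G * G)) *+ 4 =
     ('X *+ 4 * G * G) * (Q - G * G - 'X * (Q * Q)) +
     (1 + G - 'X * (G * Q) *+ 2) * (G - 1 - 'X * (G * Q) *+ 2).
    by ring.
  by apply: smallD; apply: smallM.
move=> /(_ i.+1 (ltnSn _)).
have hP k : (k < M)%N -> (G * G)`_k = \sum_(j < k.+1) ceven j * ceven (k - j)%N.
  by move=> hk; rewrite coef_truncM.
rewrite !coefB coefMn coefXM coef1 /= hP // subr0 coefM => /eqP.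
rewrite subr_eq0 => /eqP ->; rewrite cpow_conv -sumrMnl; apply: eq_bigr => j _.
have hj := ltn_ord j.
by rewrite !hP ?IH /M //; lia.
Qed.

(* The coefficients of [2G^2 - Q = Q / G]. *)
Definition cquot (i : nat) : int := cpow i *+ 2 - codd i.

Lemma small_cquot M (G := \poly_(i < M) ceven i) (Q := \poly_(i < M) codd i) :
  small M (\poly_(i < M) cquot i - (G * G *+ 2 - Q)).
Proof.
rewrite /G /Q => i hi; rewrite !coefB coefMn coef_truncM // ceven_square !coef_poly hi.
exact: subrr.
Qed.

(** Multiplying [Q = G^2 + xQ^2] by [2G] and replacing [2xGQ] by [G - 1] gives [(2G^2 - Q)G = Q]. *)
Lemma cquot_ceven i : \sum_(j < i.+1) cquot j * ceven (i - j)%N = codd i.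
Proof.
pose M := i.+1; pose G := \poly_(k < M) ceven k; pose Q := \poly_(k < M) codd k.
pose B := \poly_(k < M) cquot k.
have hG := @small_ceven M; have hQ := @small_codd M; have hB := @small_cquot M.
rewrite -/G -/Q -/B in hG hQ hB.
have : small M (B * G - Q).
  have -> : B * G - Q =
     G * (B - (G * G *+ 2 - Q)) - G *+ 2 * (Q - G * G - 'X * (Q * Q))
       + Q * (G - 1 - 'X * (G * Q) *+ 2) by ring.
  by rewrite -mulNr; do !apply: smallD; apply: smallM.
move=> /(_ i (ltnSn _)); rewrite coefB coef_truncM // coef_poly ltnSn.
by move/eqP; rewrite subr_eq0 => /eqP.
Qed.

(** In series, [x(2G^2 - Q)Q = G(G - 1) - (Q - G^2)]. This sums the cuts of an even polygon along a
    class centred at a vertex, where the outer factors are odd-indexed. *)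
Lemma cquot_codd i :
  \sum_(j < i.+1) cquot j * codd (i - j)%N = cpow i.+1 *+ 2 - ceven i.+1 - codd i.+1.
Proof.
pose M := i.+2; pose G := \poly_(k < M) ceven k; pose Q := \poly_(k < M) codd k.
pose B := \poly_(k < M) cquot k.
have hG := @small_ceven M; have hQ := @small_codd M; have hB := @small_cquot M.
rewrite -/G -/Q -/B in hG hQ hB.
have : small M ('X * (B * Q) - (G * G *+ 2 - G - Q)).
  have -> : 'X * (B * Q) - (G * G *+ 2 - G - Q) =
     'X * Q * (B - (G * G *+ 2 - Q)) + (Q - G * G - 'X * (Q * Q))
       + - G * (G - 1 - 'X * (G * Q) *+ 2) by ring.
  by apply: smallD; [apply: smallD => //|]; apply: smallM.
move=> /(_ i.+1 (ltnSn _)); rewrite !coefB coefMn coefXM !coef_truncM // !coef_poly.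
by rewrite ltnSn ceven_square => /eqP; rewrite subr_eq0 => /eqP.
Qed.

End GeneratingFunctions.

(** * Maximal conflict-free sets *)

(* The kernel equation: for an irreflexive symmetric conflict relation it says
   that [T] is a maximal conflict-free subset of [E]. *)
Definition maxfree (V : finType) (R : rel V) (E T : {set V}) : bool :=
  T == [set x in E | [forall y in T, ~~ R x y]].

Lemma maxfreeP (V : finType) (R : rel V) (E T : {set V}) :
  reflect (T \subset E /\ {in E, forall x, (x \in T) = [forall y in T, ~~ R x y]})
          (maxfree R E T).
Proof.
apply: (iffP eqP) => [HT|[sTE HT]].
  split=> [|x xE]; last by rewrite {1}HT inE xE.
  by apply/subsetP => x; rewrite HT inE => /andP[].
apply/setP => x; rewrite inE; case: (boolP (x \in E)) => [/HT // | /= xE].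
by apply/negbTE/(contra _ xE)/subsetP.
Qed.

Lemma maxfree_sub (V : finType) (R : rel V) (E T : {set V}) :
  maxfree R E T -> T \subset E.
Proof. by case/maxfreeP. Qed.

Lemma maxfree_free (V : finType) (R : rel V) (E T : {set V}) x y :
  maxfree R E T -> x \in T -> y \in T -> ~~ R x y.
Proof.
case/maxfreeP => sTE HT xT yT; move: (xT); rewrite HT ?(subsetP sTE) //.
by move/forall_inP; apply.
Qed.

Definition num_avoiding (V : finType) (R : rel V) (E A : {set V}) : nat :=
  #|[set T | maxfree R E T & [disjoint T & A]]|.

(** Abstract form of cutting a polygon along [d]: what is compatible with [d] falls into two sides
    that never conflict. *)
Record separates (V : finType) (R : rel V) (E : {set V}) (d : V) (E1 E2 : {set V})
    : Prop := Separates {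
  sep_mem : d \in E;
  sep_part : forall x, (x \in E1 :|: E2) = [&& x \in E, x != d & ~~ R d x];
  sep_disj : [disjoint E1 & E2];
  sep_free : forall x y, x \in E1 -> y \in E2 -> ~~ R x y }.

Lemma separates_sym (V : finType) (R : rel V) (E : {set V}) d E1 E2 :
  symmetric R -> separates R E d E1 E2 -> separates R E d E2 E1.
Proof.
move=> Rsym [dE part dis free]; split=> //; first by move=> x; rewrite setUC.
  by rewrite disjoint_sym.
by move=> x y xE yE; rewrite Rsym free.
Qed.

(** An element of [E1] conflicts neither with [d] nor with [E2], so only members of [T :&: E1] can
    exclude it. *)
Lemma maxfree_restrict (V : finType) (R : rel V) (E E1 E2 T : {set V}) d :
  symmetric R -> separates R E d E1 E2 -> maxfree R E T -> d \in T ->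
  maxfree R E1 (T :&: E1).
Proof.
move=> Rsym [dE part dis free] mT dT; apply/maxfreeP; rewrite subsetIr; split=> // x xE1.
have /and3P[xE xd Rdx] : [&& x \in E, x != d & ~~ R d x] by rewrite -part inE xE1.
have [sTE HT] := maxfreeP _ _ _ mT.
rewrite inE xE1 andbT HT //; apply/forall_inP/forall_inP => H y; last first.
  move=> yT; have [-> | yd] := eqVneq y d; first by rewrite Rsym.
  have : y \in E1 :|: E2 by rewrite part yd (subsetP sTE) //= (maxfree_free mT).
  by rewrite inE => /orP[yE1|]; [apply: H; rewrite inE yT | apply: free].
by rewrite inE => /andP[/H].
Qed.

Lemma maxfree_glue (V : finType) (R : rel V) (E E1 E2 T1 T2 : {set V}) d :
  symmetric R -> irreflexive R -> separates R E d E1 E2 ->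
  maxfree R E1 T1 -> maxfree R E2 T2 -> maxfree R E (d |: (T1 :|: T2)).
Proof.
move=> Rsym Rirr S m1 m2; have [dE part dis free] := S.
have [s1 H1] := maxfreeP _ _ _ m1; have [s2 H2] := maxfreeP _ _ _ m2.
have s12 x : x \in T1 :|: T2 -> [&& x \in E, x != d & ~~ R d x].
  by rewrite -part; apply/subsetP/setUSS.
apply/maxfreeP; split=> [|x xE].
  by apply/subsetP => x /setU1P[->//|/s12/and3P[]].
rewrite in_setU1; have [-> | xd] /= := eqVneq x d.
  by apply/esym/forall_inP => y /setU1P[->|/s12/and3P[]//]; rewrite Rirr.
case: (boolP (R d x)) => Rdx.
  transitivity false; last first.
    by apply/esym/forall_inP => /(_ d); rewrite setU11 Rsym Rdx => /(_ isT).
  by apply/negP => /s12; rewrite Rdx !andbF.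
(* One side of the cut, with generic names so that it applies to [E1] and to [E2]. *)
have key (F1 F2 U1 U2 : {set V}) : U1 \subset F1 -> U2 \subset F2 -> [disjoint F1 & F2] ->
   {in F1, forall x, (x \in U1) = [forall y in U1, ~~ R x y]} ->
   (forall x y, x \in F1 -> y \in F2 -> ~~ R x y) -> x \in F1 ->
   (x \in U1 :|: U2) = [forall y in d |: (U1 :|: U2), ~~ R x y].
  move=> sU1 sU2 dF HU fr xF; rewrite inE.
  have /negbTE -> : x \notin U2.
    by apply: contraL dF => /(subsetP sU2) xF2; apply/pred0Pn; exists x; rewrite /= xF.
  rewrite orbF HU //; apply/forall_inP/forall_inP => H y.
    case/setU1P => [->|]; first by rewrite Rsym.
    by case/setUP => [/H//|/(subsetP sU2)]; apply: fr.
  by move=> yU; apply: H; rewrite !inE yU orbT.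
have : x \in E1 :|: E2 by rewrite part xE xd.
case/setUP; first exact: (key _ _ _ _ s1 s2 dis H1 free).
rewrite [T1 :|: T2]setUC; apply: (key _ _ _ _ s2 s1 _ H2).
  by rewrite disjoint_sym.
by move=> a b aE bE; rewrite Rsym free.
Qed.

(** Restriction to the two sides and gluing along [d] are inverse bijections, and avoidance of [A]
    is tested on each side separately. *)
Lemma num_avoiding_cut (V : finType) (R : rel V) (E E1 E2 A : {set V}) d :
  symmetric R -> irreflexive R -> separates R E d E1 E2 -> d \notin A ->
  #|[set T | [&& maxfree R E T, [disjoint T & A] & d \in T]]| =
  num_avoiding R E1 A * num_avoiding R E2 A.
Proof.
move=> Rsym Rirr S dA; have S' := separates_sym Rsym S.
have [dE part dis free] := S.
rewrite /num_avoiding -cardsX.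
pose glue (p : {set V} * {set V}) := d |: (p.1 :|: p.2).
have d1 : d \notin E1 by have := part d; rewrite eqxx andbF inE; case: (d \in E1).
have d2 : d \notin E2 by have := part d; rewrite eqxx andbF inE; case: (d \in E2); rewrite ?orbT.
have glueE1 (T1 T2 : {set V}) : T1 \subset E1 -> T2 \subset E2 -> glue (T1, T2) :&: E1 = T1.
  move=> s1 s2; rewrite /glue !setIUl /= (setIidPl s1).
  have -> : [set d] :&: E1 = set0 by apply/disjoint_setI0; rewrite disjoints1.
  have -> : T2 :&: E1 = set0.
    by apply/disjoint_setI0; apply: disjointWl s2 _; rewrite disjoint_sym.
  by rewrite set0U setU0.
have glueE2 (T1 T2 : {set V}) : T1 \subset E1 -> T2 \subset E2 -> glue (T1, T2) :&: E2 = T2.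
  move=> s1 s2; rewrite /glue !setIUl /= (setIidPl s2).
  have -> : [set d] :&: E2 = set0 by apply/disjoint_setI0; rewrite disjoints1.
  have -> : T1 :&: E2 = set0 by apply/disjoint_setI0; apply: disjointWl s1 _.
  by rewrite !set0U.
rewrite -[RHS](card_in_imset (f := glue)); last first.
  move=> [a b] [a' b']; rewrite !inE /=.
  move=> /andP[/andP[/maxfree_sub a1 _] /andP[/maxfree_sub b1 _]].
  move=> /andP[/andP[/maxfree_sub a2 _] /andP[/maxfree_sub b2 _]] e.
  congr (_, _); first by rewrite -(glueE1 _ _ a1 b1) e glueE1.
  by rewrite -(glueE2 _ _ a1 b1) e glueE2.
congr #|pred_of_set _|; apply/setP => T; rewrite inE.
apply/and3P/imsetP => [[mT dT dinT] | [[a b]]]; last first.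
  rewrite !inE => /andP[/andP[ma da] /andP[mb db]] -> /=; split.
  - exact: maxfree_glue S _ _.
  - rewrite disjoints_subset !subUset sub1set inE dA /=.
    by rewrite -!disjoints_subset; apply/andP.
  - exact: setU11.
exists (T :&: E1, T :&: E2).
  rewrite !inE (maxfree_restrict Rsym S) // (maxfree_restrict Rsym S') //.
  by rewrite !(disjointWl (subsetIl _ _) dT).
apply/setP => x; rewrite /glue /= -setIUr in_setU1 !in_setI part.
have [-> // | xd /=] := eqVneq x d.
case: (boolP (x \in T)) => //= xT.
by rewrite (subsetP (maxfree_sub mT)) // (maxfree_free mT).
Qed.

Lemma num_avoiding_add (V : finType) (R : rel V) (E A : {set V}) d :
  num_avoiding R E A = num_avoiding R E (d |: A) +
    #|[set T | [&& maxfree R E T, [disjoint T & A] & d \in T]]|.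
Proof.
rewrite /num_avoiding -(cardsID [set T : {set V} | d \in T]) addnC; congr (_ + _).
  apply: eq_card => T; rewrite !inE andbCA; congr (_ && _).
  rewrite [RHS]disjoint_sym [RHS]disjoints_subset subUset sub1set inE.
  by rewrite -disjoints_subset disjoint_sym.
by apply: eq_card => T; rewrite !inE -andbA.
Qed.

Lemma num_avoiding0 (V : finType) (R : rel V) (E A : {set V}) :
  [disjoint E & A] -> num_avoiding R E A = num_avoiding R E set0.
Proof.
move=> dEA; apply: eq_card => T; rewrite !inE.
case: (boolP (maxfree R E T)) => //= /maxfree_sub sTE.
by rewrite (disjointWl sTE dEA) disjoint_sym disjoints_subset sub0set.
Qed.

Lemma sum_card_maxfree (V : finType) (R : rel V) (E : {set V}) :
  \sum_(T | maxfree R E T) #|T| = \sum_(d in E) #|[set T | maxfree R E T & d \in T]|.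
Proof.
transitivity (\sum_(T | maxfree R E T) \sum_(d in E) (d \in T)).
  apply: eq_bigr => T /maxfree_sub sTE.
  rewrite -sum1_card big_mkcond [RHS]big_mkcond /=; apply: eq_bigr => d _.
  case: (boolP (d \in T)) => [/(subsetP sTE) -> // | _].
  by case: ifP.
rewrite exchange_big; apply: eq_bigr => d _ /=.
rewrite -sum1_card big_mkcond [RHS]big_mkcond; apply: eq_bigr => T _.
by rewrite inE; do 2!case: ifP => //=; case: (d \in T).
Qed.

(** * Diagonals of a polygon *)

(** Plain naturals keep the index conditions within reach of [lia]. Given [j < k], the last
    condition only excludes the side [(0, k - 1)]. *)
Definition diag (k i j : nat) : bool := [&& i.+1 < j, j < k & j < i + k.-1].

Definition crossn (i j i' j' : nat) : bool :=
  ((i < i' < j) && (j < j')) || ((i' < i < j') && (j' < j)).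

(* [phi] realises the diagonals of a [k]-gon as vertices of the conflict graph [R]. *)
Record embeds (V : finType) (R : rel V) (k : nat) (phi : nat -> nat -> V) : Prop := Embeds {
  emb_inj : forall i j i' j', diag k i j -> diag k i' j' ->
    phi i j = phi i' j' -> i = i' /\ j = j';
  emb_cross : forall i j i' j', diag k i j -> diag k i' j' ->
    R (phi i j) (phi i' j') = crossn i j i' j' }.

Definition chords (V : finType) (k : nat) (phi : nat -> nat -> V) : {set V} :=
  [set phi p.1 p.2 | p : 'I_k * 'I_k & diag k p.1 p.2].

Lemma chordsP (V : finType) k (phi : nat -> nat -> V) x :
  reflect (exists i j, diag k i j /\ x = phi i j) (x \in chords k phi).
Proof.
apply: (iffP imsetP) => [[[i j] /=]|[i [j [hd ->]]]].
  by rewrite inE => hd ->; exists i, j.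
have [hi hj] : i < k /\ j < k by move: hd; rewrite /diag; lia.
by exists (Ordinal hi, Ordinal hj); rewrite ?inE.
Qed.

Definition inner (V : Type) (phi : nat -> nat -> V) (i : nat) : nat -> nat -> V :=
  fun x y => phi (i + x) (i + y).

(** Labels of the outer polygon: the vertices strictly between [i] and [j] are dropped, so [i + 1]
    is sent to [j]. *)
Definition skip (i j x : nat) : nat := if x <= i then x else x + (j - i).-1.

Lemma skipP i j x :
  (x <= i /\ skip i j x = x) \/ (i < x /\ skip i j x = x + (j - i).-1).
Proof. by rewrite /skip; case: leqP; [left | right]. Qed.

Definition outer (V : Type) (phi : nat -> nat -> V) (i j : nat) : nat -> nat -> V :=
  fun x y => phi (skip i j x) (skip i j y).

Lemma diag_inner k i j x y :
  diag k i j -> diag (j - i).+1 x y -> diag k (i + x) (i + y).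
Proof. rewrite /diag; lia. Qed.

Lemma diag_outer k i j x y :
  diag k i j -> diag (k - (j - i)).+1 x y -> diag k (skip i j x) (skip i j y).
Proof. rewrite /diag; have := skipP i j x; have := skipP i j y; lia. Qed.

(** Crossing depends only on the order of the endpoints, and the relabelling is strictly increasing.
    Pieces of a polygon are thus polygons in the same graph [R], so inductions can vary [k] and
    [phi] alone. *)
Lemma embeds_inner (V : finType) (R : rel V) k phi i j :
  embeds R k phi -> diag k i j -> embeds R (j - i).+1 (inner phi i).
Proof.
case=> inj crs hd; split=> a b a' b' ha hb; rewrite /inner.
  by case/(inj _ _ _ _ (diag_inner hd ha) (diag_inner hd hb)); lia.
by rewrite (crs _ _ _ _ (diag_inner hd ha) (diag_inner hd hb)) /crossn; lia.
Qed.

Lemma embeds_outer (V : finType) (R : rel V) k phi i j :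
  embeds R k phi -> diag k i j -> embeds R (k - (j - i)).+1 (outer phi i j).
Proof.
case=> inj crs hd; split=> a b a' b' ha hb; rewrite /outer.
  case/(inj _ _ _ _ (diag_outer hd ha) (diag_outer hd hb)).
  have := (skipP i j a, skipP i j b); have := (skipP i j a', skipP i j b').
  by move=> [] ? ? [] ? ?; lia.
rewrite (crs _ _ _ _ (diag_outer hd ha) (diag_outer hd hb)) /crossn.
move: hd; rewrite /diag.
have := (skipP i j a, skipP i j b); have := (skipP i j a', skipP i j b').
by move=> [] ? ? [] ? ?; lia.
Qed.

(** A chord that does not cross [(i, j)] has both ends in [[i, j]] or no end strictly between [i]
    and [j]. *)
Lemma separates_diag (V : finType) (R : rel V) k phi i j :
  embeds R k phi -> diag k i j ->
  separates R (chords k phi) (phi i j)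
    (chords (j - i).+1 (inner phi i)) (chords (k - (j - i)).+1 (outer phi i j)).
Proof.
move=> [inj crs] hd; split.
- by apply/chordsP; exists i, j.
- move=> x; rewrite inE; apply/orP/and3P => [[]|].
  + case/chordsP => a [b [h ->]]; have h' := diag_inner hd h; split.
    * by apply/chordsP; exists (i + a), (i + b).
    * apply/eqP => /(inj _ _ _ _ h' hd); move: h hd; rewrite /diag; lia.
    * by rewrite crs // /crossn; move: h hd; rewrite /diag; lia.
  + case/chordsP => a [b [h ->]]; have h' := diag_outer hd h; split.
    * by apply/chordsP; exists (skip i j a), (skip i j b).
    * apply/eqP => /(inj _ _ _ _ h' hd); move: h hd; rewrite /diag.
      by have := skipP i j a; have := skipP i j b; lia.
    * rewrite crs // /crossn; move: h hd; rewrite /diag.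
      by have := skipP i j a; have := skipP i j b; lia.
  case=> /chordsP[a [b [h ->]]] ne; rewrite crs // => nc.
  case: (boolP ((i <= a) && (b <= j))) => hab; [left|right]; apply/chordsP.
    have [ia ib] : i <= a /\ i <= b by move: h hab; rewrite /diag; lia.
    exists (a - i), (b - i); rewrite /inner !subnKC //.
    split=> //; move: ne nc h hd hab; rewrite /diag /crossn.
    have [->|] := eqVneq a i; have [->|] := eqVneq b j; rewrite ?eqxx; lia.
  (* [u] inverts [skip i j] on the vertices of the outer polygon. *)
  pose u x := if x <= i then x else x - (j - i).-1.
  have [ea eb] : skip i j (u a) = a /\ skip i j (u b) = b.
    move: nc h hd hab (skipP i j (u a)) (skipP i j (u b)).
    by rewrite /diag /crossn /u; case: (leqP a i) => ?; case: (leqP b i) => ? /=; lia.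
  exists (u a), (u b); rewrite /outer ea eb; split=> //.
  by move: nc h hd hab; rewrite /diag /crossn /u; case: (leqP a i) => ?; case: (leqP b i) => ? /=; lia.
- apply/pred0Pn => -[x /= /andP[/chordsP[a [b [h ->]]] /chordsP[a' [b' [h' e]]]]].
  have [] := inj _ _ _ _ (diag_inner hd h) (diag_outer hd h') e.
  by move: h h' hd (skipP i j a') (skipP i j b'); rewrite /diag; lia.
- move=> x y /chordsP[a [b [h ->]]] /chordsP[a' [b' [h' ->]]].
  rewrite (crs _ _ _ _ (diag_inner hd h) (diag_outer hd h')).
  by move: h h' hd (skipP i j a') (skipP i j b'); rewrite /diag /crossn; lia.
Qed.

(** Cutting along a member gives pieces whose sizes add up to [k + 2], and
    [(k1 - 3) + (k2 - 3) + 1 = k - 3]. *)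
Lemma card_maxfree (V : finType) (R : rel V) k phi T :
  symmetric R -> irreflexive R -> embeds R k phi -> 3 <= k ->
  maxfree R (chords k phi) T -> #|T| = k - 3.
Proof.
move=> Rsym Rirr; elim/ltn_ind: k phi T => k IH phi T emb k3 mT.
have sT := maxfree_sub mT.
have [k4 | k4] := leqP k 3.
  have -> : k - 3 = 0 by lia.
  apply/eqP; rewrite cards_eq0 -subset0; apply: subset_trans sT _.
  by apply/subsetP => x /chordsP[i [j [h _]]]; move: h; rewrite /diag; lia.
(* For [k > 3] the empty set is not maximal: [(0, 2)] could be added. *)
have [x xT] : exists x, x \in T.
  apply/set0Pn; apply: contraTneq mT => ->.
  apply/negP => /maxfreeP[_ /(_ (phi 0 2))].
  rewrite inE => H; suff : false by [].
  rewrite H; first by apply/forall_inP => y; rewrite inE.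
  by apply/chordsP; exists 0, 2; rewrite /diag; split=> //; lia.
have /chordsP[i [j [hd ex]]] := subsetP sT _ xT; subst x.
have S := separates_diag emb hd; have S' := separates_sym Rsym S.
have [dE part dis free] := S.
have h1 := IH _ _ _ _ (embeds_inner emb hd) _ (maxfree_restrict Rsym S mT xT).
have h2 := IH _ _ _ _ (embeds_outer emb hd) _ (maxfree_restrict Rsym S' mT xT).
set E1 := chords (j - i).+1 _ in dis part h1; set E2 := chords _ (outer _ _ _) in dis part h2.
have -> : #|T| = (#|T :&: E1| + #|T :&: E2|).+1.
  rewrite (cardsD1 (phi i j)) xT add1n; congr _.+1.
  rewrite -cardsUI.
  have -> : (T :&: E1) :&: (T :&: E2) = set0.
    by rewrite setIACA (disjoint_setI0 dis) setI0.
  rewrite cards0 addn0 -setIUr; apply: eq_card => x; rewrite !inE -in_setU part.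
  case: (boolP (x \in T)) => xT' /=; last by rewrite andbF.
  by rewrite (subsetP sT) // (maxfree_free mT) //= !andbT.
by rewrite h1 ?h2; move: hd; rewrite /diag; lia.
Qed.

(** * Counting all triangulations of a polygon *)

Lemma sum_differences (G : nat -> nat) k : G 0 = 0 ->
  \sum_(i < k) \sum_(j < k) G (j - i) = \sum_(l < k) (k - l) * G l.
Proof.
move=> G0; rewrite exchange_big /=; elim: k => [|k IH]; first by rewrite !big_ord0.
rewrite big_ord_recr /=.
under eq_bigr => j _.
  rewrite big_ord_recr /= (_ : j - k = 0) ?G0 ?addn0; last by have := ltn_ord j; lia.
  over.
rewrite IH.
have -> : \sum_(i < k.+1) G (k - i) = \sum_(i < k.+1) G i.
  rewrite (reindex_inj rev_ord_inj) /=; apply: eq_bigr => i _.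
  by rewrite subSS subKn // -ltnS.
transitivity (\sum_(l < k.+1) (k - l) * G l + \sum_(l < k.+1) G l).
  by rewrite [in RHS]big_ord_recr /= subnn mul0n addn0.
rewrite -big_split; apply: eq_bigr => i _ /=.
by rewrite -mulSnr subSn // -ltnS.
Qed.

(** The sum runs over the diagonals of an [(m + 2)]-gon by span [l]. Including the side spans [1]
    and [m + 1] it would be [(2m + 1) C_m], by symmetry and [catalanS]; these two contribute
    [(m + 1) C_m] and [C_m]. *)
Lemma catalan_diag m : 0 < m ->
  \sum_(l < m.+2) (m.+2 - l) *
     (if 1 < l < m.+1 then catalan l.-1 * catalan (m - l.-1) else 0) =
  m.-1 * catalan m.
Proof.
move=> m0; rewrite big_ord_recl /= muln0 add0n.
have H : \sum_(i < m.+1) (m.+1 - i) * (catalan i * catalan (m - i)) =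
         m.*2.+1 * catalan m.
  have E : \sum_(i < m.+1) (m.+1 - i) * (catalan i * catalan (m - i)) +
       \sum_(i < m.+1) i * (catalan i * catalan (m - i)) = m.+1 * catalan m.+1.
    rewrite segner big_distrr -big_split /=; apply: eq_bigr => i _.
    by rewrite -mulnDl subnK // ltnW.
  have := sum_conv_sym catalan m; rewrite -segner.
  by have := catalanS m; move: E; lia.
move: H; case: m m0 => // m _.
rewrite big_ord_recl big_ord_recr [in X in _ -> X]big_ord_recl [in X in _ -> X]big_ord_recr /=.
rewrite /bump /= !add1n !ltnn /= !subn0 subnn (_ : catalan 0 = 1) //.
set x := \sum_(i < m) _; set y := \sum_(i < m) _; have -> : y = x; last by lia.
by apply: eq_bigr => i _; rewrite ifT; last by have := ltn_ord i; lia.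
Qed.

Lemma chords3 (V : finType) (phi : nat -> nat -> V) : chords 3 phi = set0.
Proof.
apply/setP => x; rewrite inE; apply/chordsP => -[i [j []]].
by rewrite /diag; lia.
Qed.

Lemma num_maxfree (V : finType) (R : rel V) k phi :
  symmetric R -> irreflexive R -> embeds R k phi -> 3 <= k ->
  num_avoiding R (chords k phi) set0 = catalan (k - 2).
Proof.
move=> Rsym Rirr; elim/ltn_ind: k phi => k IH phi emb k3.
have E0 (E : {set V}) : num_avoiding R E set0 = #|[set T | maxfree R E T]|.
  apply: eq_card => T; rewrite !inE disjoint_sym disjoints_subset sub0set.
  by rewrite andbT.
have [k4 | k4] := leqP k 3.
  have -> : k = 3 by lia.
  rewrite chords3 E0; transitivity #|[set (set0 : {set V})]|; last by rewrite cards1.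
  apply: eq_card => T; rewrite !inE /maxfree.
  by congr (_ == _); apply/setP => x; rewrite !inE.
have [m em] : exists m, k = m.+3 by exists (k - 3); lia.
subst k.
have m0 : 0 < m by lia.
suff : m * num_avoiding R (chords m.+3 phi) set0 = m * catalan m.+1.
  by move/eqP; rewrite eqn_pmul2l // => /eqP ->; rewrite !subSS subn0.
transitivity (\sum_(T | maxfree R (chords m.+3 phi) T) #|T|).
  rewrite E0 -sum1_card big_distrr /=; apply: eq_big => [T|T]; rewrite inE //.
  by move/(card_maxfree Rsym Rirr emb k3) ->; rewrite muln1 !subSS subn0.
(* [g] vanishes at the side spans [1] and [m + 2] and at [0], the truncated difference of a pair in
   the wrong order, so the sum over diagonals extends to all pairs. *)
pose g l := if 1 < l < m.+2 then catalan l.-1 * catalan (m.+1 - l.-1) else 0.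
rewrite sum_card_maxfree -[m in RHS]/(m.+1.-1) -catalan_diag //.
rewrite -(@sum_differences g) // pair_big /=.
rewrite big_imset /=; last first.
  move=> [a b] [a' b']; rewrite !inE /= => h h' /(emb_inj emb h h') [ea eb].
  by congr (_, _); apply: val_inj.
rewrite [RHS](bigID (fun p : 'I_m.+3 * 'I_m.+3 => diag m.+3 p.1 p.2)) /=.
rewrite [X in _ = _ + X]big1 ?addn0; last first.
  move=> [a b] /=; rewrite /g; case: ifP => // H; rewrite /diag.
  by have := ltn_ord b; lia.
apply: eq_big => [[a b] | [a b]]; rewrite ?inE //= => h.
rewrite /g ifT; last by move: h; rewrite /diag; lia.
transitivity (#|[set T | [&& maxfree R (chords m.+3 phi) T, [disjoint T & set0] & phi a b \in T]]|).
  apply: eq_card => T; rewrite !inE disjoint_sym disjoints_subset sub0set.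
  by rewrite andTb.
rewrite (num_avoiding_cut Rsym Rirr (separates_diag emb h)) ?inE //.
rewrite (IH _ _ _ (embeds_inner emb h)) ?(IH _ _ _ (embeds_outer emb h)).
- by congr (catalan _ * catalan _); move: h; rewrite /diag; lia.
all: by move: h; rewrite /diag; lia.
Qed.

(** * Avoiding a parallel class *)

(* [r] consecutive members of a parallel class, listed outwards from the vertex
   [m] ([e = 0]) or from the side [(m, m + 1)] ([e = 1]). *)
Definition par (V : finType) (phi : nat -> nat -> V) (m e r : nat) : {set V} :=
  [set phi (m - j.+1) (m + e + j.+1) | j : 'I_r].

Lemma parP (V : finType) (phi : nat -> nat -> V) m e r x :
  reflect (exists2 j, j < r & x = phi (m - j.+1) (m + e + j.+1)) (x \in par phi m e r).
Proof.
apply: (iffP imsetP) => [[j _ ->]|[j hj ->]]; first by exists j.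
by exists (Ordinal hj).
Qed.

Lemma parS (V : finType) (phi : nat -> nat -> V) m e r :
  par phi m e r.+1 = phi (m - r.+1) (m + e + r.+1) |: par phi m e r.
Proof.
apply/setP => x; rewrite in_setU1; apply/parP/predU1P => [[j]|[->|/parP[j hj ->]]].
- rewrite ltnS leq_eqVlt => /predU1P[-> ->|hj ->]; [by left | right].
  by apply/parP; exists j.
- by exists r.
- by exists j => //; rewrite ltnW.
Qed.

(** Inside the polygon cut off by the next member, the class is again of the same shape, with middle
    relabelled [r + 1]. *)
Lemma par_inner (V : finType) (phi : nat -> nat -> V) m e r : r < m ->
  par (inner phi (m - r.+1)) r.+1 e r = par phi m e r.
Proof.
move=> hr; apply: eq_imset => j; rewrite /inner; congr phi; have := ltn_ord j; lia.
Qed.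

(** In the inner polygon cut off by member [r], which has [2r + e + 3] vertices, the general count
    collapses to [b r]: this is the top term of the convolution, since [C_0 = 1]. *)
Lemma par_formula (b : nat -> int) e r
    (bE : (\sum_(i < r.+1) b i * (catalan (r - i).*2)%:Z =
           (catalan (r.*2 + e).+1)%:Z)%R) :
  ((catalan ((r.*2 + e).+3 - 2))%:Z -
    \sum_(j < r) b j * (catalan ((r.*2 + e).+3 - (j.*2 + e + 3)))%:Z = b r)%R.
Proof.
rewrite !subSS subn0 -bE big_ord_recr /= subnn mulr1 addrAC.
rewrite (_ : (_ - _)%R = 0%R) ?add0r //; apply/eqP; rewrite subr_eq0; apply/eqP.
by apply: eq_bigr => j _; congr (_ * (catalan _)%:Z)%R; have := ltn_ord j; lia.
Qed.

(** Induction on [r]: those that avoid the first [r] members but contain the next one are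
    subtracted. The hypothesis is used for the whole polygon and for the inner piece, hence the
    generality in [k], [phi] and [m]. The last inequality keeps the members off the side
    [(0, k - 1)]. *)
Lemma num_avoiding_par (b : nat -> int) e
    (bE : forall j, (\sum_(i < j.+1) b i * (catalan (j - i).*2)%:Z =
                     (catalan (j.*2 + e).+1)%:Z)%R)
    r (V : finType) (R : rel V) k phi m :
  symmetric R -> irreflexive R -> embeds R k phi -> 3 <= k ->
  r <= m -> m + e + r < k -> m + e + r < m - r + k.-1 ->
  ((num_avoiding R (chords k phi) (par phi m e r))%:Z =
   (catalan (k - 2))%:Z - \sum_(j < r) b j * (catalan (k - (j.*2 + e + 3)))%:Z)%R.
Proof.
move=> Rsym Rirr; elim: r k phi m => [|r IH] k phi m emb k3 rm mk mk'.
  rewrite big_ord0 subr0 -(num_maxfree Rsym Rirr emb k3); congr (Posz (num_avoiding _ _ _)).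
  by apply/setP => x; rewrite inE; apply/parP => -[].
have hd : diag k (m - r.+1) (m + e + r.+1) by rewrite /diag; lia.
have S := separates_diag emb hd.
have pE1 : par phi m e r \subset
    chords (m + e + r.+1 - (m - r.+1)).+1 (inner phi (m - r.+1)).
  rewrite -par_inner //; apply/subsetP => x /parP[j hj ->]; apply/chordsP.
  by exists (r.+1 - j.+1), (r.+1 + e + j.+1); split=> //; rewrite /diag; lia.
have dP : phi (m - r.+1) (m + e + r.+1) \notin par phi m e r.
  apply/negP => /(subsetP pE1) d1; have := sep_part S (phi (m - r.+1) (m + e + r.+1)).
  by rewrite inE d1 eqxx andbF.
have IHk : ((num_avoiding R (chords k phi) (par phi m e r))%:Z =
   (catalan (k - 2))%:Z - \sum_(j < r) b j * (catalan (k - (j.*2 + e + 3)))%:Z)%R.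
  by apply: IH => //; lia.
have IH1 : ((num_avoiding R (chords (m + e + r.+1 - (m - r.+1)).+1
     (inner phi (m - r.+1))) (par phi m e r))%:Z = b r)%R.
  rewrite -par_inner //; rewrite (IH _ _ _ (embeds_inner emb hd)); try lia.
  have -> : ((m + e + r.+1 - (m - r.+1)).+1 = (r.*2 + e).+3)%N by lia.
  exact: par_formula.
move: IHk; rewrite (num_avoiding_add _ _ _ (phi (m - r.+1) (m + e + r.+1))).
rewrite (num_avoiding_cut Rsym Rirr S dP) -parS PoszD PoszM IH1.
rewrite [X in (b r * Posz X)%R]num_avoiding0; last first.
  by apply: disjointWr pE1 _; rewrite disjoint_sym (sep_disj S).
rewrite (num_maxfree Rsym Rirr (embeds_outer emb hd)); last first.
  by move: hd; rewrite /diag; lia.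
have -> : ((k - (m + e + r.+1 - (m - r.+1))).+1 - 2 = k - (r.*2 + e + 3))%N by lia.
by rewrite [in X in _ -> X]big_ord_recr /= => H; rewrite opprD addrA -H addrK.
Qed.

(** A [(2r + e + 3)]-gon has exactly [r] diagonals in such a class; the range of [m] ensures that
    none wraps past the label [0]. *)
Lemma num_avoiding_all_par (b : nat -> int) e
    (bE : forall j, (\sum_(i < j.+1) b i * (catalan (j - i).*2)%:Z =
                     (catalan (j.*2 + e).+1)%:Z)%R)
    r (V : finType) (R : rel V) phi m :
  symmetric R -> irreflexive R -> embeds R (r.*2 + e).+3 phi ->
  r <= m <= r.+2 ->
  ((num_avoiding R (chords (r.*2 + e).+3 phi) (par phi m e r))%:Z = b r)%R.
Proof.
move=> Rsym Rirr emb rm.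
by rewrite (num_avoiding_par bE Rsym Rirr emb) ?par_formula //; lia.
Qed.

(** The middle-side equation [xBG = G - 1] has the solution [B = 2Q], because [G = 1 + 2xGQ]. *)
Lemma codd_sum i : (\sum_(j < i.+1) codd j *+ 2 * (catalan (i - j).*2)%:Z =
   (catalan (i.*2 + 1).+1)%:Z)%R.
Proof.
rewrite addn1 -doubleS -/(ceven _) ceven_conv (reindex_inj rev_ord_inj) /=.
apply: eq_bigr => j _; rewrite subSS subKn -1?ltnS; last exact: ltn_ord.
by rewrite mulrnAl mulrC.
Qed.

(** * Triangulations as maximal conflict-free sets of chords *)

Lemma cross_sym N : symmetric (@cross N).
Proof. by move=> d e; rewrite /cross orbC. Qed.

Lemma cross_irr N : irreflexive (@cross N).
Proof. by move=> d; rewrite /cross !ltnn. Qed.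

(** Since [cross] is symmetric and irreflexive, inserting [d] breaks non-crossing exactly when [d]
    crosses a member. *)
Lemma triangulationE N (T : {set 'I_N * 'I_N}) :
  triangulation T = maxfree (@cross N) [set d | is_diag d] T.
Proof.
apply/and3P/maxfreeP => [[/forall_inP hT /forall_inP ncT /forallP mT] | [sT HT]].
  split=> [|d]; first by apply/subsetP => d /hT; rewrite inE.
  rewrite inE => dd; apply/idP/forall_inP => [dT | H].
    exact/forall_inP/ncT.
  apply: contraT => dT; have := mT d; rewrite dd dT /= => /negP[].
  apply/forall_inP => x /setU1P[->|xT]; apply/forall_inP => y /setU1P[->|yT].
  - by rewrite cross_irr.
  - exact: H.
  - by rewrite cross_sym H.
  - by move/forall_inP: (ncT _ xT); apply.
have Td d : d \in T -> is_diag d by move/(subsetP sT); rewrite inE.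
split; first exact/forall_inP.
  by apply/forall_inP => x xT; rewrite -HT // inE Td.
apply/forallP => d; apply/implyP => /andP[dd dT]; apply: contra dT => /forall_inP H.
rewrite HT ?inE //; apply/forall_inP => y yT.
by move/forall_inP: (H d (setU11 _ _)); apply; rewrite setU1r.
Qed.

(** [inord] sends labels out of range to [0]; every use is guarded by [diag] or by bounds. *)
Definition vtx (N i j : nat) : 'I_N.+1 * 'I_N.+1 := (inord i, inord j).

Lemma vtx_val N k i j : k <= N.+1 -> diag k i j ->
  ((vtx N i j).1 = i :> nat) * ((vtx N i j).2 = j :> nat).
Proof. by move=> kN h; rewrite /= !inordK //; move: h; rewrite /diag; lia. Qed.

Lemma embeds_vtx N : embeds (@cross N.+1) N.+1 (vtx N).
Proof.
split=> i j i' j' h h'; last by rewrite /cross !(vtx_val (leqnn _) h, vtx_val (leqnn _) h').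
move=> E; have [a b] := vtx_val (leqnn _) h; have [a' b'] := vtx_val (leqnn _) h'.
by rewrite -[in LHS]a -[in X in _ /\ X]b E a' b'.
Qed.

Lemma chords_vtx N : 0 < N -> chords N.+1 (vtx N) = [set d | is_diag d].
Proof.
move=> N0; apply/setP => -[a b]; rewrite inE /is_diag /=; apply/chordsP/idP.
  case=> i [j [h E]]; have [ea eb] := vtx_val (leqnn _) h.
  by rewrite -E /= in ea eb; move: h; rewrite ea eb /diag; lia.
move=> h; exists a, b; rewrite /vtx !inord_val; split=> //.
by move: h; rewrite /diag; have := ltn_ord b; lia.
Qed.

Lemma f_countE x y N (A : {set 'I_N.+1 * 'I_N.+1}) : 0 < N ->
  (forall i j, diag N.+1 i j -> parallel N.+1 i j x y = (vtx N i j \in A)) ->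
  f_count x y N.+1 = num_avoiding (@cross N.+1) (chords N.+1 (vtx N)) A.
Proof.
move=> N0 HA; apply: eq_card => T; rewrite !inE triangulationE -chords_vtx //.
case: (boolP (maxfree _ _ _)) => //= /maxfree_sub sT.
rewrite disjoints_subset; apply/forall_inP/subsetP => H d dT;
  have /chordsP[i [j [h E]]] := subsetP sT _ dT; have := H d dT;
  have [ea eb] := vtx_val (leqnn _) h; rewrite E in_setC ea eb HA //.
Qed.

(** * Parallel classes as label sums modulo the number of vertices *)

Lemma vtx_inj N i j i' j' : i <= N -> j <= N -> i' <= N -> j' <= N ->
  vtx N i j = vtx N i' j' -> i = i' /\ j = j'.
Proof.
move=> iN jN i'N j'N [/(congr1 val) + /(congr1 val)].
by rewrite /= !inordK.
Qed.

Lemma vtx_par N i j m e r : diag N.+1 i j -> e <= 1 -> r <= m -> m + e + r <= N ->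
  (vtx N i j \in par (vtx N) m e r) = (i + j == m.*2 + e) && (m - r <= i).
Proof.
move=> h e1 rm mN; have [hi hj] : i <= N /\ j <= N by move: h; rewrite /diag; lia.
apply/parP/andP => [[t tr /vtx_inj E]|[/eqP ei mi]].
  by have [] := E; lia.
exists (m - i.+1); first by move: h; rewrite /diag; lia.
by congr vtx; move: h; rewrite /diag; lia.
Qed.

(** Two labels add up to less than [2N], so a parallel class consists of at most two values of the
    sum. *)
Lemma eqn_mod_small N s t : s < N -> t < N.*2 ->
  (t == s %[mod N]) = (t == s) || (t == s + N).
Proof.
move=> sN tN; rewrite (modn_small sN); have [tN' | Nt] := ltnP t N.
  by rewrite modn_small //; lia.
by rewrite -[in LHS](subnK Nt) modnDr modn_small; lia.
Qed.

(** With [N = 2l + 4], the sum [1] is only the side itself, so the diagonals have sum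
    [N + 1 = 2(l + 2) + 1], around the opposite side [(l + 2, l + 3)]. *)
Lemma f_even_side l : ((f_count 0 1 (l.*2 + 1).+3)%:Z = codd l *+ 2)%R.
Proof.
rewrite (@f_countE _ _ _ (par (vtx (l.*2 + 1).+2) l.+2 1 l)) //; last first.
  move=> i j h; rewrite vtx_par //; try lia.
  rewrite /parallel eqn_mod_small; try (move: h; rewrite /diag; lia).
apply: (@num_avoiding_all_par (fun j => codd j *+ 2)%R).
- exact: codd_sum.
- exact: cross_sym.
- exact: cross_irr.
- exact: embeds_vtx.
- lia.
Qed.

Lemma cquot_sum i : (\sum_(j < i.+1) cquot j * (catalan (i - j).*2)%:Z =
   (catalan (i.*2 + 0).+1)%:Z)%R.
Proof. by rewrite addn0; apply: cquot_ceven. Qed.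

(** With [N = 2l + 3], the diagonals have sum [N + 1 = 2(l + 2)], around the vertex [l + 2] opposite
    to the side. *)
Lemma f_odd_side l : ((f_count 0 1 (l.*2 + 0).+3)%:Z = cquot l)%R.
Proof.
rewrite (@f_countE _ _ _ (par (vtx (l.*2 + 0).+2) l.+2 0 l)) //; last first.
  move=> i j h; rewrite vtx_par //; try lia.
  by rewrite /parallel eqn_mod_small; move: h; rewrite /diag; lia.
apply: (num_avoiding_all_par cquot_sum); try lia.
- exact: cross_sym.
- exact: cross_irr.
- exact: embeds_vtx.
Qed.

(* The class of [(0, 2)] has middle vertices [1] and [l + 3]; its members are
   listed outwards from [l + 3], and [(0, 2)] itself, whose far side is not an
   interval of vertices, is cut off separately. *)
Lemma f_even_short l : ((f_count 0 2 l.*2.+4)%:Z =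
  codd l.+1 + ceven l.+1 *+ 2 - cpow l.+1 *+ 2)%R.
Proof.
set phi := vtx l.*2.+3; set A := par phi l.+3 0 l.
have emb : embeds (@cross l.*2.+4) l.*2.+4 phi by exact: embeds_vtx.
have hd : diag l.*2.+4 0 2 by rewrite /diag; lia.
have S := separates_diag emb hd.
(* Cutting off vertex [1] shifts the middle [l + 3] down to [l + 2]. *)
have par_outer : par (outer phi 0 2) l.+2 0 l = A.
  apply: eq_imset => t; rewrite /outer /skip; have := ltn_ord t => tl.
  by rewrite !ifF ?addn1 //; [congr phi|..]; lia.
have dA : phi 0 2 \notin A by rewrite vtx_par //; lia.
rewrite (@f_countE _ _ _ (phi 0 2 |: A)) //; last first.
  move=> i j h; rewrite in_setU1 vtx_par //; try lia.
  (* The sum [2] is attained by the diagonal [(0, 2)] alone; the sum [N + 2 = 2(l + 3)] gives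
     [A]. *)
  rewrite /parallel eqn_mod_small; try by move: h; rewrite /diag; lia.
  have -> : (vtx l.*2.+3 i j == phi 0 2) = (i == 0) && (j == 2).
    apply/eqP/andP => [/vtx_inj H|[/eqP-> /eqP->//]].
    by have [] := H; move: h; rewrite /diag; lia.
  by move: h; rewrite /diag; lia.
have all_chords := num_avoiding_par cquot_sum (@cross_sym _) (@cross_irr _) emb
  (r := l) (m := l.+3); rewrite -/A in all_chords.
have out k : k = (l.*2 + 0).+3 -> embeds (@cross _) k (outer phi 0 2) ->
    ((num_avoiding (@cross _) (chords k (outer phi 0 2)) A)%:Z = cquot l)%R.
  move=> -> eO; rewrite -par_outer.
  by apply: (num_avoiding_all_par cquot_sum (@cross_sym _) (@cross_irr _)) => //; lia.
move: all_chords; rewrite (num_avoiding_add _ _ A (phi 0 2)).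
rewrite (num_avoiding_cut (@cross_sym _) (@cross_irr _) S dA).
rewrite chords3 [num_avoiding _ set0 _]num_avoiding0; last by rewrite -setI_eq0 set0I.
rewrite -[X in num_avoiding _ X set0](chords3 (inner phi 0)).
rewrite (num_maxfree (@cross_sym _) (@cross_irr _) (embeds_inner emb hd)) //.
rewrite mul1n PoszD (out _ _ (embeds_outer emb hd)); last by lia.
move=> H.
rewrite -[LHS](addrK (cquot l)) H; try lia.
(* The correction [cquot l] for triangulations through [(0, 2)] is exactly the missing term [j = l],
   as [codd 0 = 1]. *)
have := cquot_codd l; rewrite big_ord_recr /= subnn mulr1.
have -> : (\sum_(j < l) cquot j * (catalan (l.*2.+4 - (j.*2 + 0 + 3)))%:Z =
           \sum_(j < l) cquot j * codd (l - j)%N)%R.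
  apply: eq_bigr => j _; congr (_ * (catalan _)%:Z)%R; have := ltn_ord j; lia.
rewrite !subSS subn0 -doubleS -/(ceven _) => E.
by rewrite -addrA -opprD E; ring.
Qed.

Local Open Scope ring_scope.

Theorem theorem2 :
  (forall n : nat, (2 <= n)%N ->
     (f_count 0 1 (2 * n))%:Z = 2%:Z * (catalan (2 * n - 3))%:Z) /\
  (forall n : nat, (2 <= n)%N ->
     (f_count 0 2 (2 * n))%:Z =
       (catalan (2 * n - 1))%:Z + 2%:Z * (catalan (2 * n - 2))%:Z
       - (2 ^ (2 * n - 1))%:Z * (catalan (n - 1))%:Z) /\
  (forall n : nat, (1 <= n)%N ->
     (f_count 0 1 (2 * n + 1))%:Z =
       (2 ^ (2 * n - 1))%:Z * (catalan (n - 1))%:Z - (catalan (2 * n - 1))%:Z).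
Proof.
split; [|split] => n n1.
- have [l ->] : exists l, n = l.+2 by exists (n - 2)%N; lia.
  have -> : (2 * l.+2 = (l.*2 + 1).+3)%N by lia.
  rewrite f_even_side (_ : (_ - 3)%N = l.*2.+1); last by lia.
  by rewrite -mulr_natl.
- have [l ->] : exists l, n = l.+2 by exists (n - 2)%N; lia.
  have -> : (2 * l.+2 = l.*2.+4)%N by lia.
  rewrite f_even_short /codd /ceven /cpow !subSS !subn0 doubleS PoszM.
  rewrite (_ : (2 ^ l.*2.+3 = 2 * 4 ^ l.+1)%N) ?PoszM; last first.
    by rewrite -[4%N]/(2 ^ 2)%N -expnM -expnS; congr (2 ^ _)%N; lia.
  by ring.
- have [l ->] : exists l, n = l.+1 by exists (n - 1)%N; lia.
  have -> : (2 * l.+1 + 1 = (l.*2 + 0).+3)%N by lia.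
  rewrite f_odd_side /cquot /codd /cpow subSS subn0 PoszM.
  have -> : (2 * l.+1 - 1 = l.*2.+1)%N by lia.
  rewrite (_ : (2 ^ l.*2.+1 = 2 * 4 ^ l)%N) ?PoszM; last first.
    by rewrite -[4%N]/(2 ^ 2)%N -expnM -expnS; congr (2 ^ _)%N; lia.
  by ring.
Qed.
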